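(* Let $R$ be a left noetherian ring and $n\geq 0$ an integer. Then $\bigoplus_{i=0}^n I_i(R)$ is an injective cogenerator for the category of left $R$-modules of flat dimension at most $n$.
   Context: $0\to R\to I_0(R)\to I_1(R)\to\cdots$ denotes the minimal injective resolution of $R$ as a left $R$-module. For a full subcategory $\mathcal A$ of the category of all left $R$-modules, a left $R$-module $X$ is a cogenerator for $\mathcal A$ if every object of $\mathcal A$ admits an injection into some direct product of copies of $X$; an injective cogenerator is a cogenerator that is an injective module. *)

(* Defs.v *)
From HB Require Import structures.
From mathcomp Require Import all_boot all_algebra generic_quotient.
From mathcomp Require Import boolp classical_sets functions.

Set Implicit Arguments.
Unset Strict Implicit.
Unset Printing Implicit Defensive.

Import GRing.Theory.
Local Open Scope ring_scope.
Local Open Scope quotient_scope.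

(* Rings are [pzRingType]s: associative and unital, not necessarily
   commutative, the zero ring included.  [lmodType R] is the type of left
   R-modules, [R^o] is R as a left module over itself, and a right R-module is
   an [lmodType R^c], with [a r] written [(r : R^c) *: a]. *)

Definition submodule (R : pzRingType) (V : lmodType R) (S : set V) : Prop :=
  [/\ S 0,
      forall x y, S x -> S y -> S (x + y)
    & forall r x, S x -> S (r *: x)].

Definition left_noetherian (R : pzRingType) : Prop :=
  forall J : nat -> set R^o,
    (forall i, submodule (J i)) ->
    (forall i, J i `<=` J i.+1)%classic ->
    exists N, forall i, (N <= i)%N -> J i = J N.

Definition ker (R : pzRingType) (U V : lmodType R) (f : {linear U -> V}) :
  set U := [set x | f x = 0]%classic.

(* The abelian group A (x)_R M is the quotient of the finite formal sums of
   pairs (a, m), encoded as lists, by the congruence generated by the bilinear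
   relations.  With [tensor_zero], the class of [(- a, m)] is the opposite of
   that of [(a, m)], so this monoid is a group. *)
Inductive tensor_rel (R : pzRingType) (A : lmodType R^c) (M : lmodType R) :
    seq (A * M) -> seq (A * M) -> Prop :=
| tensor_refl s : tensor_rel s s
| tensor_sym s t : tensor_rel s t -> tensor_rel t s
| tensor_trans s t u : tensor_rel s t -> tensor_rel t u -> tensor_rel s u
| tensor_cat s s' t t' :
    tensor_rel s s' -> tensor_rel t t' -> tensor_rel (s ++ t) (s' ++ t')
| tensor_comm s t : tensor_rel (s ++ t) (t ++ s)
| tensor_zero m : tensor_rel [:: (0, m)] [::]
| tensor_addl a b m : tensor_rel [:: (a + b, m)] [:: (a, m); (b, m)]
| tensor_addr a m m' : tensor_rel [:: (a, m + m')] [:: (a, m); (a, m')]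
| tensor_scale (r : R) a m :
    tensor_rel [:: ((r : R^c) *: a, m)] [:: (a, r *: m)].

Section Tensor.
Variables (R : pzRingType) (A : lmodType R^c) (M : lmodType R).

Definition tensor_relb (s t : seq (A * M)) : bool := `[< tensor_rel s t >].

Lemma tensor_relb_equiv : equiv_class_of tensor_relb.
Proof.
split=> [s|s t|t s u].
- by apply/asboolP; exact: tensor_refl.
- by apply/idP/idP => /asboolP h; apply/asboolP; exact: tensor_sym.
- by move=> /asboolP h /asboolP k; apply/asboolP; exact: tensor_trans h k.
Qed.

Canonical tensor_equiv := EquivRelPack tensor_relb_equiv.

Definition tensor : Type := {eq_quot tensor_equiv}.

HB.instance Definition _ := Choice.on tensor.
HB.instance Definition _ := EqQuotient.on tensor.

Lemma tensor_eqP (s t : seq (A * M)) :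
  \pi_tensor s = \pi_tensor t <-> tensor_rel s t.
Proof.
split=> [/eqmodP/asboolP //|h].
by apply/eqmodP/asboolP.
Qed.

Definition tensor0 : tensor := \pi_tensor [::].
Definition tensorD (x y : tensor) : tensor := \pi_tensor (repr x ++ repr y).
Definition tensorN (x : tensor) : tensor :=
  \pi_tensor [seq (- p.1, p.2) | p <- repr x].

Lemma tensorD_pi s t :
  tensorD (\pi_tensor s) (\pi_tensor t) = \pi_tensor (s ++ t).
Proof.
by apply/tensor_eqP; apply: tensor_cat; apply/tensor_eqP; rewrite reprK.
Qed.

Lemma tensorDA : associative tensorD.
Proof.
move=> x y z; rewrite -[x]reprK -[y]reprK -[z]reprK.
by rewrite !tensorD_pi !reprK catA.
Qed.

Lemma tensorDC : commutative tensorD.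
Proof. by move=> x y; apply/tensor_eqP; exact: tensor_comm. Qed.

Lemma tensor0D : left_id tensor0 tensorD.
Proof. by move=> x; rewrite -[x]reprK tensorD_pi. Qed.

Lemma tensor_rel_opp (s : seq (A * M)) :
  tensor_rel ([seq (- p.1, p.2) | p <- s] ++ s) [::].
Proof.
elim: s => [|[a m] s IH] /=; first exact: tensor_refl.
set t := map _ s in IH *.
have h1 : tensor_rel ((- a, m) :: t ++ (a, m) :: s)
                     ([:: (- a, m); (a, m)] ++ (t ++ s)).
  apply: (@tensor_cat _ _ _ [:: (- a, m)] [:: (- a, m)]).
    exact: tensor_refl.
  rewrite -cat_rcons -cats1 -(cat1s _ (t ++ s)) catA.
  by apply: tensor_cat; [exact: tensor_comm | exact: tensor_refl].
apply: (tensor_trans h1).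
apply: (@tensor_cat _ _ _ _ [::] _ [::]); last exact: IH.
apply: tensor_trans (tensor_zero _ m).
by rewrite -(addNr a); apply: tensor_sym; exact: tensor_addl.
Qed.

Lemma tensorND : left_inverse tensor0 tensorN tensorD.
Proof.
move=> x; rewrite -{2}[x]reprK /tensorN tensorD_pi.
by apply/tensor_eqP; exact: tensor_rel_opp.
Qed.

HB.instance Definition _ :=
  GRing.isZmodule.Build tensor tensorDA tensorDC tensor0D tensorND.

Definition pure_tensor (a : A) (m : M) : tensor := \pi_tensor [:: (a, m)].

Definition balanced (G : zmodType) (g : A -> M -> G) : Prop :=
  [/\ forall a b m, g (a + b) m = g a m + g b m,
      forall a m m', g a (m + m') = g a m + g a m'
    & forall (r : R) a m, g ((r : R^c) *: a) m = g a (r *: m)].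

Definition tensor_lift (G : zmodType) (g : A -> M -> G) (x : tensor) : G :=
  \sum_(p <- repr x) g p.1 p.2.

Lemma pure_tensor_balanced : balanced pure_tensor.
Proof.
split=> [a b m|a m m'|r a m].
- by rewrite [RHS]tensorD_pi; apply/tensor_eqP; exact: tensor_addl.
- by rewrite [RHS]tensorD_pi; apply/tensor_eqP; exact: tensor_addr.
- by apply/tensor_eqP; exact: tensor_scale.
Qed.

Lemma tensor_sum_pure (s : seq (A * M)) :
  \pi_tensor s = \sum_(p <- s) pure_tensor p.1 p.2.
Proof.
elim: s => [|[a m] s IH]; first by rewrite big_nil.
by rewrite big_cons -IH [RHS]tensorD_pi.
Qed.

Section Universal.
Variables (G : zmodType) (g : A -> M -> G).
Hypothesis bal : balanced g.

Lemma tensor_lift_rel s t : tensor_rel s t ->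
  \sum_(p <- s) g p.1 p.2 = \sum_(p <- t) g p.1 p.2.
Proof.
have [gDl gDr gZ] := bal.
elim=> {s t} [//|s t _ -> //|s t u _ -> _ -> //|s s' t t' _ h _ k|s t|m|a b m
             |a m m'|r a m]; rewrite ?big_cat ?big_cons ?big_nil ?addr0 /=.
- by rewrite h k.
- by rewrite addrC.
- by apply: (addIr (g 0 m)); rewrite -gDl !add0r.
- by rewrite gDl.
- by rewrite gDr.
- by rewrite gZ.
Qed.

Lemma tensor_lift_pi s :
  tensor_lift g (\pi_tensor s) = \sum_(p <- s) g p.1 p.2.
Proof. by apply: tensor_lift_rel; apply/tensor_eqP; rewrite reprK. Qed.

Lemma tensor_lift_pure a m : tensor_lift g (pure_tensor a m) = g a m.
Proof. by rewrite tensor_lift_pi big_seq1. Qed.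

Lemma tensor_liftD x y :
  tensor_lift g (x + y) = tensor_lift g x + tensor_lift g y.
Proof. by rewrite [LHS]tensor_lift_pi big_cat. Qed.

Lemma tensor_lift_unique (h : {additive tensor -> G}) :
  (forall a m, h (pure_tensor a m) = g a m) -> h =1 tensor_lift g.
Proof.
move=> hg x; rewrite -[x in LHS]reprK tensor_sum_pure raddf_sum.
by apply: eq_bigr => p _; rewrite hg.
Qed.

End Universal.
End Tensor.

(* f (x) id_M *)
Definition tensor_map (R : pzRingType) (A B : lmodType R^c) (M : lmodType R)
    (f : {linear A -> B}) : tensor A M -> tensor B M :=
  tensor_lift (fun a m => pure_tensor (f a) m).

Lemma tensor_map_balanced (R : pzRingType) (A B : lmodType R^c)
    (M : lmodType R) (f : {linear A -> B}) :
  balanced (fun a (m : M) => pure_tensor (f a) m).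
Proof.
have [pDl pDr pZ] := pure_tensor_balanced B M.
by split=> [a b m|a m m'|r a m]; rewrite ?linearD ?linearZ /= ?pDl ?pDr ?pZ.
Qed.

Definition flat (R : pzRingType) (M : lmodType R) : Prop :=
  forall (A B : lmodType R^c) (f : {linear A -> B}),
    injective f -> injective (@tensor_map R A B M f).

(* M has a flat resolution 0 -> F n -> ... -> F 0 -> M -> 0. *)
Definition flat_dim_le (R : pzRingType) (n : nat) (M : lmodType R) : Prop :=
  exists (F : nat -> lmodType R) (d : forall i, {linear F i.+1 -> F i})
         (e : {linear F 0%N -> M}),
    [/\ forall i, flat (F i),
        forall i, (n < i)%N -> forall x : F i, x = 0,
        range e = [set: M]%classic,
        range (d 0%N) = ker e
      & forall i, range (d i.+1) = ker (d i)].

Definition injective_module (R : pzRingType) (E : lmodType R) : Prop :=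
  forall (A B : lmodType R) (f : {linear A -> B}) (g : {linear A -> E}),
    injective f -> exists h : {linear B -> E}, forall a, h (f a) = g a.

Definition essential (R : pzRingType) (V : lmodType R) (S : set V) : Prop :=
  forall T : set V, submodule T ->
    (T `&` S `<=` [set 0])%classic -> (T `<=` [set 0])%classic.

(* 0 -> M -> E 0 -> E 1 -> ... is exact, E 0 is an injective hull of M, and
   E i.+1 is an injective hull of the image of d i, i.e. of the cokernel of
   the preceding map. *)
Definition minimal_injective_resolution (R : pzRingType) (M : lmodType R)
    (E : nat -> lmodType R) (eps : {linear M -> E 0%N})
    (d : forall i, {linear E i -> E i.+1}) : Prop :=
  [/\ [/\ injective eps,
          range eps = ker (d 0%N)
        & forall i, range (d i) = ker (d i.+1)],
      forall i, injective_module (E i),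
      essential (range eps)
    & forall i, essential (range (d i))].

Arguments minimal_injective_resolution [R] M E eps d.

(* A full subcategory is given by a predicate on modules; the module [I -> X]
   is the direct product of copies of X indexed by I. *)
Definition cogenerator_for (R : pzRingType) (C : lmodType R -> Prop)
    (X : lmodType R) : Prop :=
  forall Y : lmodType R, C Y ->
    exists (I : Type) (f : {linear Y -> (I -> X)}), injective f.

Definition injective_cogenerator_for (R : pzRingType)
    (C : lmodType R -> Prop) (X : lmodType R) : Prop :=
  injective_module X /\ cogenerator_for C X.

(* E 0 (+) ... (+) E n, as an iterated binary product. *)
Fixpoint direct_sum (R : pzRingType) (E : nat -> lmodType R) (n : nat) :
    lmodType R :=
  if n is n'.+1 then (direct_sum E n' * E n'.+1)%type : lmodType R else E 0%N.

(* Main.v *)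
Require Import Defs.
From mathcomp Require Import all_boot all_algebra generic_quotient.
From HB Require Import structures.
From mathcomp Require Import boolp classical_sets functions.
Import GRing.Theory.
Local Open Scope ring_scope.

Set Implicit Arguments.
Unset Strict Implicit.
Unset Printing Implicit Defensive.

(** Suppose that x in a module Y of flat dimension at most n is killed by every
map from Y to I 0, ..., I n; the claim is that x = 0. Put X = Rx. A map from X
to I i extends to Y because I i is injective, so Hom(X, I i) = 0 for i <= n.
Shifting dimensions along the injective resolution of R gives Ext^i(X, R) = 0
for i <= n. Since R is left noetherian, X has a resolution P by finitely
generated free modules, hence Hom(P, F) is Hom(P, R) tensored with F, and so
Ext^i(X, F) = 0 for i <= n and every flat F. Shifting dimensions along a flat
resolution of Y of length n then gives Hom(X, Y) = 0, so the inclusion of X in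
Y is zero and x = 0.

The proof makes this argument concrete. The resolution P is a sequence of
matrices D i of size q i.+1 by q i, acting on rows by right multiplication
([cyclic_free_resolution]). A map from a free module to N is a tuple of elements
of N, on which matrices act by [act], and the vanishing of an Ext group is the
exactness, at one place, of the sequence of tuples ([hom_exact]). Stating that
exactness for tuples with entries in a given subset of N lets kernels and images
play the role of syzygies without becoming modules of their own. Both dimension
shifts, [hom_exact_ker] and [hom_exact_range], are then manipulations of tuples.
The passage from R to flat modules is [flat_hom_exact], and the two resolutions
are chased in [eq0_of_maps_to_resolution]. *)

(** * Submodules as modules *)

Section SubmoduleType.
Variables (R : pzRingType) (V : lmodType R) (S : set V).

(** The proof that S is a submodule is an argument so that the closure
properties can be inferred from the predicate. *)
Definition submodule_pred of submodule S : {pred V} := fun x => `[< S x >].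

Variable subS : submodule S.

Fact submodule_pred_closed : submod_closed (submodule_pred subS).
Proof.
have [S0 SD SZ] := subS; split; first exact/asboolP.
by move=> a x y /asboolP Sx /asboolP Sy; apply/asboolP/SD => //; exact: SZ.
Qed.

HB.instance Definition _ :=
  GRing.isSubmodClosed.Build R V (submodule_pred subS) submodule_pred_closed.

Record submodule_type :=
  SubmoduleElt { submodule_val : V; _ : submodule_val \in submodule_pred subS }.

HB.instance Definition _ := [isSub for submodule_val].
HB.instance Definition _ := [Choice of submodule_type by <:].
HB.instance Definition _ := [SubChoice_isSubLmodule of submodule_type by <:].

End SubmoduleType.

Lemma submodule_is_module (R : pzRingType) (V : lmodType R) (S : set V) :
  submodule S ->
  exists (U : lmodType R) (i : {linear U -> V}), injective i /\ range i = S.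
Proof.
move=> subS; exists (submodule_type subS : lmodType R).
exists (\val : {linear submodule_type subS -> V}); split; first exact: val_inj.
apply/seteqP; split=> [_ [[x Sx] _ <-]|x Sx] /=; first exact/asboolP.
have Sx' : x \in submodule_pred subS by apply/asboolP.
by exists (SubmoduleElt Sx').
Qed.

(** * Finite generation over a left noetherian ring *)

Lemma ker_submodule (R : pzRingType) (V W : lmodType R)
  (g : {linear V -> W}) : submodule (ker g).
Proof.
split=> [|x y gx gy|r x gx]; rewrite /ker /= ?linear0 //.
  by rewrite linearD gx gy addr0.
by rewrite linearZ /= gx scaler0.
Qed.

Lemma submoduleI (R : pzRingType) (V : lmodType R) (S T : set V) :
  submodule S -> submodule T -> submodule (S `&` T)%classic.
Proof.
move=> [S0 SD SZ] [T0 TD TZ].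
split=> [//|x y [Sx Tx] [Sy Ty]|r x [Sx Tx]].
  by split; [exact: SD|exact: TD].
by split; [exact: SZ|exact: TZ].
Qed.

(** Quantifying over the submodules that contain the generators, instead of
exhibiting linear combinations, makes [fin_gen_ext] a matter of inclusions. *)
Definition fin_gen (R : pzRingType) (V : lmodType R) (S : set V) : Prop :=
  exists2 l : seq V, {in l, forall y, S y} &
    forall T : set V, submodule T -> {in l, forall y, T y} ->
      (S `<=` T)%classic.

Definition span (R : pzRingType) (V : lmodType R) (l : seq V) : set V :=
  [set x | forall T : set V,
    submodule T -> {in l, forall y, T y} -> T x]%classic.

Lemma span_submodule (R : pzRingType) (V : lmodType R) (l : seq V) :
  submodule (span l).
Proof.
split=> [T [] //|x y Sx Sy T sT lT|r x Sx T sT lT]; have [T0 TD TZ] := sT.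
  by apply: TD; [exact: Sx|exact: Sy].
by apply: TZ; exact: Sx.
Qed.

(** If no finite part of J generated it, one could keep adjoining an element
of J outside the ideal generated so far, and obtain a strictly increasing
sequence of ideals. *)
Lemma fin_gen_ideal (R : pzRingType) (J : set R^o) :
  left_noetherian R -> submodule J -> fin_gen J.
Proof.
move=> noethR sJ; apply: contrapT => nfg.
have next (l : seq R^o) : exists x, {in l, forall y, J y} -> J x /\ ~ span l x.
  have [lJ|nlJ] := pselect {in l, forall y, J y}; last by exists 0.
  apply: contrapT => nx; apply: nfg; exists l => // T sT lT x Jx.
  apply: contrapT => nTx; apply: nx; exists x => _; split=> // /(_ T sT lT).
  exact: nTx.
have [nxt nxtP] := choice next.
pose gens := fix gens i := if i is j.+1 then nxt (gens j) :: gens j else [::].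
have gensJ i : {in gens i, forall y, J y}.
  elim: i => [|i IH] y //=; rewrite inE => /orP [/eqP ->|/IH //].
  by have [] := nxtP _ IH.
have [N stable] := noethR (fun i => span (gens i))
  (fun i => span_submodule (gens i))
  (fun i x gx T sT lT => gx T sT
     (fun y yl => lT y (mem_behead (s := _ :: _) yl))).
have [_] := nxtP _ (gensJ N); rewrite -(stable _ (leqnSn N)) /=; apply.
by move=> T sT; apply; exact: mem_head.
Qed.

(** Generators of S are obtained from those of its part in the kernel of g and
from lifts of generators of the left ideal g(S). *)
Lemma fin_gen_ext (R : pzRingType) (V : lmodType R) (g : {linear V -> R^o})
    (S : set V) : left_noetherian R -> submodule S ->
  fin_gen (S `&` ker g)%classic -> fin_gen S.
Proof.
move=> noethR sS [l0 l0S l0gen]; have [S0 SD SZ] := sS.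
have sJ (T : set V) : submodule T -> submodule (g @` T)%classic.
  case=> T0 TD TZ; split; first by exists 0; rewrite ?linear0.
    move=> _ _ [x Tx <-] [y Ty <-]; exists (x + y); rewrite ?linearD //.
    exact: TD.
  by move=> r _ [x Tx <-]; exists (r *: x); rewrite ?linearZ //; exact: TZ.
have [l lJ lgen] := fin_gen_ideal noethR (sJ S sS).
have liftP a : exists x, a \in l -> S x /\ g x = a.
  have [/lJ [x Sx <-]|_] := boolP (a \in l); first by exists x.
  by exists 0.
have [lift {}liftP] := choice liftP.
exists (map lift l ++ l0).
  move=> y; rewrite mem_cat => /orP [/mapP [a /liftP [Sa _] -> //]|].
  by move=> /l0S [].
move=> T sT lT x Sx; have [T0 TD TZ] := sT.
have sST := submoduleI sS sT.
have [t [St Tt] gtx] : (g @` (S `&` T))%classic (g x).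
  apply: (lgen _ (sJ _ sST)) => [a al|]; last by exists x.
  have [Sa <-] := liftP a al; exists (lift a) => //; split=> //.
  by apply: lT; rewrite mem_cat map_f.
have Txt : T (x - t).
  apply: (l0gen T sT) => [y yl|].
    by apply: lT; rewrite mem_cat yl orbT.
  split; first by rewrite -scaleN1r; apply: SD => //; apply: SZ.
  by rewrite /ker /= linearB /= gtx subrr.
by rewrite -(subrK t x); exact: TD.
Qed.

(** Induction on the number k of coordinates that may be nonzero, the last of
them being the linear form to which [fin_gen_ext] is applied. *)
Lemma fin_gen_row (R : pzRingType) q (S : set 'rV[R]_q) :
  left_noetherian R -> submodule S -> fin_gen S.
Proof.
move=> noethR.
suff H k (T : set 'rV[R]_q) : submodule T ->
    (forall a, T a -> forall j : 'I_q, (k <= j)%N -> a 0 j = 0) -> fin_gen T.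
  by move=> sS; apply: (H q) => // a _ j; rewrite leqNgt ltn_ord.
elim: k T => [|k IH] T sT Tk; have [T0 TD TZ] := sT.
  exists [::] => // U [U0 _ _] _ a /Tk a0.
  by rewrite (_ : a = 0) //; apply/rowP => j; rewrite mxE a0.
have [kq|qk] := ltnP k q; last first.
  by apply: IH => // a Ta j kj; have := leq_trans qk kj; rewrite leqNgt ltn_ord.
pose g (a : 'rV[R]_q) : R^o := a 0 (Ordinal kq).
have lin_g : linear g by move=> r a b; rewrite /g !mxE.
pose gL := GRing.isLinear.Build R 'rV[R]_q R^o *:%R g lin_g.
pose g' : {linear 'rV[R]_q -> R^o} := HB.pack g gL.
apply: (@fin_gen_ext _ _ g') => //; apply: IH.
  exact: submoduleI sT (ker_submodule g').
move=> a [Ta ga] j; rewrite leq_eqVlt => /orP [/eqP kj|]; last exact: Tk.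
by rewrite (_ : j = Ordinal kq); [exact: ga|apply: val_inj; rewrite /= -kj].
Qed.

Lemma row_span_matrix (R : pzRingType) q (S : set 'rV[R]_q) :
  left_noetherian R -> submodule S ->
  exists r (B : 'M[R]_(r, q)), forall a, S a <-> exists c, a = c *m B.
Proof.
move=> noethR sS; have [l lS lgen] := fin_gen_row noethR sS.
have [S0 SD SZ] := sS.
pose B := \matrix_(k < size l) l`_k.
exists (size l), B => a; split.
  apply: (lgen [set b | exists c, b = c *m B]%classic) => {a}.
    split; first by exists 0; rewrite mul0mx.
      by move=> _ _ [a ->] [b ->]; exists (a + b); rewrite mulmxDl.
    by move=> r _ [a ->]; exists (r *: a); rewrite scalemxAl.
  move=> y yl; have il : (index y l < size l)%N by rewrite index_mem.
  exists (delta_mx 0 (Ordinal il)); rewrite -rowE rowK /=.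
  by rewrite nth_index.
case=> c ->; rewrite mulmx_sum_row.
apply: (big_ind S) => // i _; apply: SZ; rewrite rowK; apply: lS.
exact: mem_nth.
Qed.

(** * Matrices acting on tuples of module elements *)

Section Act.
Variables (R : pzRingType).

Definition act r q (A : 'M[R]_(r, q)) (N : lmodType R) (u : 'I_q -> N) :
  'I_r -> N := fun k => \sum_j A k j *: u j.

Lemma eq_act r q (A : 'M[R]_(r, q)) (N : lmodType R) (u v : 'I_q -> N) :
  u =1 v -> act A u =1 act A v.
Proof. by move=> uv k; apply: eq_bigr => j _; rewrite uv. Qed.

Lemma act_mul r q p (A : 'M[R]_(r, q)) (B : 'M[R]_(q, p)) (N : lmodType R)
    (u : 'I_p -> N) : act (A *m B) u =1 act A (act B u).
Proof.
move=> k; rewrite /act (eq_bigr (fun i => \sum_j (A k j * B j i) *: u i)).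
  rewrite exchange_big; apply: eq_bigr => j _; rewrite scaler_sumr.
  by apply: eq_bigr => i _; rewrite scalerA.
by move=> i _; rewrite mxE scaler_suml.
Qed.

Lemma act_linear_mx r q a (A B : 'M[R]_(r, q)) (N : lmodType R)
    (u : 'I_q -> N) k :
  act (a *: A + B) u k = a *: act A u k + act B u k.
Proof.
rewrite /act scaler_sumr -big_split; apply: eq_bigr => j _.
by rewrite !mxE scalerDl scalerA.
Qed.

Lemma act_sub r q (A : 'M[R]_(r, q)) (N : lmodType R) (u v : 'I_q -> N) :
  act A (fun j => u j - v j) =1 (fun k => act A u k - act A v k).
Proof.
by move=> k; rewrite /act -sumrB; apply: eq_bigr => j _; rewrite scalerBr.
Qed.

Lemma act0 r q (A : 'M[R]_(r, q)) (N : lmodType R) :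
  act A (fun=> 0 : N) =1 fun=> 0.
Proof. by move=> k; apply: big1 => j _; rewrite scaler0. Qed.

Lemma act_map r q (A : 'M[R]_(r, q)) (N N' : lmodType R)
    (g : {linear N -> N'}) (u : 'I_q -> N) :
  act A (fun j => g (u j)) =1 (fun k => g (act A u k)).
Proof.
by move=> k; rewrite linear_sum; apply: eq_bigr => j _; rewrite linearZ.
Qed.

Lemma act_comp0 r q p (A : 'M[R]_(r, q)) (B : 'M[R]_(q, p)) (N : lmodType R)
    (u : 'I_p -> N) : A *m B = 0 -> act A (act B u) =1 fun=> 0.
Proof.
by move=> AB k; rewrite -act_mul AB; apply: big1 => j _; rewrite mxE scale0r.
Qed.

(** A tuple u with q entries in S is a linear map from the free module of rows
R^q to S, and [act B u] is its composite with right multiplication by B, from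
R^r to R^q. So this is exactness in the middle of
Hom(R^p, S) -> Hom(R^q, S) -> Hom(R^r, S). *)
Definition hom_exact r q p (A : 'M[R]_(q, p)) (B : 'M[R]_(r, q))
    (N : lmodType R) (S : set N) : Prop :=
  forall u : 'I_q -> N, (forall j, S (u j)) -> act B u =1 (fun=> 0) ->
  exists2 v : 'I_p -> N, (forall j, S (v j)) & act A v =1 u.

(** For the exact sequence 0 -> ker g -> N -> range g -> 0, this is
Ext^(i+1)(X, ker g) = 0 deduced from Ext^i(X, range g) = 0 and
Ext^(i+1)(X, N) = 0. *)
Lemma hom_exact_ker t r q p (A0 : 'M[R]_(q, p)) (A1 : 'M[R]_(r, q))
    (A2 : 'M[R]_(t, r)) (N N' : lmodType R) (g : {linear N -> N'}) :
  A1 *m A0 = 0 -> hom_exact A1 A2 [set: N]%classic ->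
  hom_exact A0 A1 (range g) -> hom_exact A1 A2 (ker g).
Proof.
move=> A10 exN exR u gu A2u.
have [//|v _ A1v] := exN u _ A2u.
have [j|k|w Rw A0w] := exR (fun j => g (v j)).
- by exists (v j).
- by rewrite act_map A1v; exact: gu.
have [w' w'E] := choice (fun j => let: ex_intro2 x _ gx := Rw j in
  ex_intro (fun x => g x = w j) x gx).
have gA0w' : act A0 w =1 fun k => g (act A0 w' k).
  by move=> k; rewrite -act_map; apply: eq_act => j; rewrite w'E.
exists (fun j => v j - act A0 w' j) => [j|k].
  by rewrite /ker /= linearB /= -gA0w' A0w subrr.
by rewrite act_sub A1v act_comp0 // subr0.
Qed.

(** For the same exact sequence, this is Ext^i(X, range g) = 0 deduced from
Ext^i(X, N) = 0 and Ext^(i+1)(X, ker g) = 0. *)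
Lemma hom_exact_range t r q p (A0 : 'M[R]_(q, p)) (A1 : 'M[R]_(r, q))
    (A2 : 'M[R]_(t, r)) (N N' : lmodType R) (g : {linear N -> N'}) :
  A2 *m A1 = 0 -> hom_exact A0 A1 [set: N]%classic ->
  hom_exact A1 A2 (ker g) -> hom_exact A0 A1 (range g).
Proof.
move=> A21 exN exK u Ru A1u.
have [u' u'E] := choice (fun j => let: ex_intro2 x _ gx := Ru j in
  ex_intro (fun x => g x = u j) x gx).
have [k||w gw A1w] := exK (act A1 u').
- rewrite /ker /= -act_map -[RHS](A1u k).
  by apply: eq_act => j; rewrite u'E.
- exact: act_comp0.
have [//|k|v _ A0v] := exN (fun j => u' j - w j).
  by rewrite act_sub A1w subrr.
exists (fun j => g (v j)) => [j|k]; first by exists (v j).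
by rewrite act_map A0v linearB /= u'E gw subr0.
Qed.

(** When the rows of A generate the relations between the y j, a tuple
satisfying these relations is a linear map on the span of the y j, which
extends to V. *)
Lemma injective_extend_family t r (V I : lmodType R) (y : 'I_r -> V)
    (A : 'M[R]_(t, r)) (u : 'I_r -> I) : injective_module I ->
  (forall a : 'rV[R]_r, act a y 0 = 0 -> exists c, a = c *m A) ->
  act A u =1 (fun=> 0) ->
  exists h : {linear V -> I}, forall j, h (y j) = u j.
Proof.
move=> injI ker_y Au.
have ker_u (a : 'rV[R]_r) : act a y 0 = 0 -> act a u 0 = 0.
  by case/ker_y => c ->; rewrite act_mul (eq_act _ Au) act0.
have sS : submodule (range (fun a : 'rV[R]_r => act a y 0)).
  split.
  - exists 0 => //; rewrite [LHS]big1 // => j _.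
    by rewrite mxE scale0r.
  - move=> _ _ [a _ <-] [b _ <-]; exists (1 *: a + b) => //.
    by rewrite act_linear_mx scale1r.
  - move=> s _ [a _ <-]; exists (s *: a) => //.
    rewrite -[s *: a]addr0 act_linear_mx [X in _ + X]big1 ?addr0 // => j _.
    by rewrite mxE scale0r.
have [U [i [inj_i Ri]]] := submodule_is_module sS.
have coefP w : exists a : 'rV[R]_r, act a y 0 = i w.
  have : range i (i w) by exists w.
  by rewrite Ri => -[a _ <-]; exists a.
have [coef {}coefP] := choice coefP.
have indep (a b : 'rV[R]_r) : act a y 0 = act b y 0 -> act a u 0 = act b u 0.
  move=> ab; apply/esym/subr0_eq.
  rewrite addrC -scaleN1r -act_linear_mx ker_u // act_linear_mx ab.
  by rewrite scaleN1r addNr.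
pose g w := act (coef w) u 0.
have lin_g : linear g.
  move=> s w w'; rewrite /g -act_linear_mx; apply: indep.
  by rewrite act_linear_mx !coefP linearP.
pose gL := GRing.isLinear.Build R U I *:%R g lin_g.
pose g' : {linear U -> I} := HB.pack g gL.
have [h hE] := injI _ _ i g' inj_i; exists h => j.
have deltaE (N : lmodType R) (z : 'I_r -> N) :
    act (delta_mx 0 j : 'rV[R]_r) z 0 = z j.
  rewrite /act (bigD1 j) //= big1 => [|k kj].
    by rewrite mxE !eqxx scale1r addr0.
  by rewrite mxE (negPf kj) scale0r.
have [w _ iw] : range i (y j) by rewrite Ri; exists (delta_mx 0 j).
by rewrite -iw hE /= /g -[RHS](deltaE I u); apply: indep; rewrite deltaE coefP.
Qed.

(** A tuple killed by A2 is a linear map on the image of A1 in R^q; the tuple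
that is sought is the restriction to the standard basis of an extension of this
map to R^q. *)
Lemma injective_hom_exact t r q (A1 : 'M[R]_(r, q)) (A2 : 'M[R]_(t, r))
    (I : lmodType R) : injective_module I ->
  (forall a : 'rV[R]_r, a *m A1 = 0 -> exists c, a = c *m A2) ->
  hom_exact A1 A2 [set: I]%classic.
Proof.
move=> injI kerA u _ A2u.
have [|h hE] := injective_extend_family (y := fun j => row j A1) injI _ A2u.
  move=> a aA; apply: kerA; rewrite -[RHS]aA mulmx_sum_row /act.
  exact: eq_bigr.
exists (fun k => h (delta_mx 0 k)) => // j.
rewrite act_map -hE; congr (h _); rewrite [RHS]row_sum_delta.
by apply: eq_bigr => k _; rewrite mxE.
Qed.

End Act.

(** * Flat modules preserve exactness of Hom complexes *)

Section Flat.
Variables (R : pzRingType) (F : lmodType R).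
Variables (q p : nat) (A : 'M[R]_(q, p)).

Let im (z : 'I_q -> F) := exists v, act A v =1 z.

Let im_eq z z' : z =1 z' -> im z -> im z'.
Proof. by move=> zz' [v Av]; exists v => k; rewrite Av. Qed.

Let im_sub z z' : im z -> im z' -> im (fun j => z j - z' j).
Proof.
move=> [v Av] [v' Av']; exists (fun j => v j - v' j) => k.
by rewrite act_sub Av Av'.
Qed.

Let im_0 : im (fun=> 0).
Proof. by exists (fun=> 0); exact: act0. Qed.

Let im_add z z' : im z -> im z' -> im (fun j => z j + z' j).
Proof.
move=> iz iz'; apply: im_eq (im_sub iz (im_sub im_0 iz')) => j.
by rewrite sub0r opprK.
Qed.

Let im_sum (J : Type) (s : seq J) (z : J -> 'I_q -> F) :
  (forall i, im (z i)) -> im (fun j => \sum_(i <- s) z i j).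
Proof.
move=> iz; elim: s => [|i s IH].
  by apply: im_eq im_0 => j; rewrite big_nil.
by apply: im_eq (im_add (iz i) IH) => j; rewrite big_cons.
Qed.

(** Let V be the right module of columns R^r and U its submodule B R^q, so that
U is R^q / A R^p by the exactness hypothesis. If B u = 0, the tensor that is the
sum of the B e_j (x) u_j vanishes in V (x) F, hence already in U (x) F by
flatness of F. Lifting elements of U to R^q sends U (x) F to F^q / A F^p, and
the image of this tensor is the class of u. *)
Lemma flat_hom_exact r (B : 'M[R]_(r, q)) :
  flat F -> hom_exact A B [set: R^o]%classic -> hom_exact A B [set: F]%classic.
Proof.
move=> flatF exR.
have exRF (c : 'I_q -> R) m :
    (forall k, \sum_j B k j * c j = 0) -> im (fun j => c j *: m).
  move=> /(exR (c : 'I_q -> R^o) (fun=> I)) [b _ Ab].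
  exists (fun k => (b k : R) *: m) => j; rewrite -Ab scaler_suml.
  by apply: eq_bigr => k _; rewrite scalerA.
move=> u _ Bu.
pose V : lmodType R^c := 'cV[R^c]_r.
pose S : set V := [set x | exists c : 'I_q -> R,
  forall k, x k 0 = \sum_j B k j * c j]%classic.
have sS : submodule S.
  split.
  - by exists (fun=> 0) => k; rewrite mxE big1 // => j _; rewrite mulr0.
  - move=> x y [c xc] [e ye]; exists (fun j => c j + e j) => k.
    rewrite mxE xc ye -big_split /=; apply: eq_bigr => j _.
    by rewrite mulrDr.
  - move=> s x [c xc]; exists (fun j => c j * (s : R)) => k.
    rewrite mxE xc [LHS]mulr_suml; apply: eq_bigr => j _.
    by rewrite mulrA.
have [U [i [inj_i Ri]]] := submodule_is_module sS.
have coefP w : exists c : 'I_q -> R, forall k,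
    (i w : V) k 0 = \sum_j B k j * c j.
  have : range i (i w) by exists w.
  by rewrite Ri.
have [c {}cP] := choice coefP.
have colP j : exists w, i w = \col_k B k j :> V.
  have [w _ iw] : range i (\col_k B k j : V).
    rewrite Ri; exists (fun j' => (j' == j)%:R) => k; rewrite mxE.
    rewrite (bigD1 j) //= eqxx mulr1 big1 ?addr0 // => j' /negPf ->.
    by rewrite mulr0.
  by exists w.
have [w wP] := choice colP.
(* The map from U (x) F to F^q / A F^p, as a function on representatives: the
   choice c of preimages is linear only up to im, so equivalence of
   representatives is compared with im. *)
pose val (s : seq (U * F)) j := \sum_(x <- s) c x.1 j *: x.2.
have val_rel s t : tensor_rel s t -> im (fun j => val s j - val t j).
  elim=> {s t}.
  - by move=> s; apply: im_eq im_0 => j; rewrite subrr.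
  - by move=> s t _ IH; apply: im_eq (im_sub im_0 IH) => j; rewrite sub0r opprB.
  - move=> s t t' _ IH _ IH'; apply: im_eq (im_add IH IH') => j.
    by rewrite addrA subrK.
  - move=> s s' t t' _ IH _ IH'; apply: im_eq (im_add IH IH') => j.
    by rewrite /val !big_cat opprD addrACA.
  - move=> s t; apply: im_eq im_0 => j.
    by rewrite /val !big_cat [X in _ - X]addrC subrr.
  - move=> m; apply: (@im_eq (fun j => c 0 j *: m)).
      by move=> j; rewrite /val big_seq1 big_nil subr0.
    by apply: exRF => k; rewrite -cP linear0 mxE.
  - move=> a b m; apply: (@im_eq (fun j =>
        (c (a + b) j - (c a j + c b j)) *: m)).
      move=> j; rewrite /val !big_cons !big_nil !addr0 /=.
      by rewrite scalerBl scalerDl.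
    apply: exRF => k.
    rewrite (eq_bigr (fun j => B k j * c (a + b) j
      - (B k j * c a j + B k j * c b j))); last first.
      by move=> j _; rewrite mulrBr mulrDr.
    by rewrite sumrB big_split /= -!cP linearD mxE subrr.
  - move=> a m m'; apply: im_eq im_0 => j.
    by rewrite /val !big_cons !big_nil !addr0 /= scalerDr subrr.
  - move=> s a m; apply: (@im_eq (fun j =>
        (c ((s : R^c) *: a) j - c a j * s) *: m)).
      by move=> j; rewrite /val !big_seq1 /= scalerBl scalerA.
    apply: exRF => k.
    rewrite (eq_bigr (fun j => B k j * c ((s : R^c) *: a) j
      - B k j * c a j * s)); last by move=> j _; rewrite mulrBr mulrA.
    by rewrite sumrB -mulr_suml -!cP linearZ mxE subrr.
pose s := [seq (w j, u j) | j <- enum 'I_q].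
have tens0 : (\pi_(tensor U F) s)%qT = 0 :> tensor U F.
  have balV := pure_tensor_balanced V F; have [bDl bDr bZ] := balV.
  have b0 a : pure_tensor (a : V) (0 : F) = 0.
    by apply: (addIr (pure_tensor a 0)); rewrite -bDr !add0r.
  have bl0 m : pure_tensor (0 : V) (m : F) = 0.
    by apply: (addIr (pure_tensor 0 m)); rewrite -bDl !add0r.
  apply: (flatF _ _ i inj_i).
  rewrite /tensor_map !(tensor_lift_pi (tensor_map_balanced F i)) big_nil.
  rewrite big_map big_enum /=.
  have bsum (J : finType) (f : J -> V) (m : F) :
      pure_tensor (\sum_j f j) m = \sum_j pure_tensor (f j) m.
    exact: (big_morph (fun a => pure_tensor a m) (fun a b => bDl a b m)
      (bl0 m)).
  have bsumr (J : finType) (a : V) (f : J -> F) :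
      pure_tensor a (\sum_j f j) = \sum_j pure_tensor a (f j).
    exact: (big_morph (pure_tensor a) (bDr a) (b0 a)).
  have colE j : (\col_k B k j : V) =
      \sum_k ((B k j : R^c) *: (delta_mx k 0 : V)).
    rewrite [LHS](@matrix_sum_delta R^c r 1); apply: eq_bigr => k _.
    by rewrite big_ord1 mxE.
  rewrite (eq_bigr (fun j =>
    \sum_k pure_tensor (delta_mx k 0 : V) (B k j *: u j))); last first.
    move=> j _; rewrite wP colE bsum.
    by apply: eq_bigr => k _; exact: bZ.
  rewrite exchange_big big1 //= => k _; rewrite -bsumr.
  by rewrite [X in pure_tensor _ X](Bu k) b0.
have := val_rel s [::] (proj1 (tensor_eqP _ _) tens0).
(* The chosen preimage of the j'-th column of B need not be the j'-th basis
   vector, but it differs from it by an element killed by B. *)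
have diff : im (fun j => \sum_(j' <- enum 'I_q)
    (c (w j') j - (j == j')%:R) *: u j').
  apply: im_sum => j'; apply: exRF => k; rewrite (eq_bigr (fun j =>
    B k j * c (w j') j - B k j * (j == j')%:R)); last first.
    by move=> j _; rewrite mulrBr.
  rewrite sumrB -cP wP mxE (bigD1 j') //= eqxx mulr1 big1 ?addr0 ?subrr //.
  by move=> j /negPf ->; rewrite mulr0.
move=> /im_sub /(_ diff) [v Av]; exists v => // j; rewrite Av.
rewrite /val big_map big_nil subr0 -sumrB big_enum /= (bigD1 j) //= big1.
  by rewrite eqxx scalerBl opprB addrCA subrr !addr0 scale1r.
by move=> j' /negPf j'j; rewrite eq_sym j'j subr0 subrr.
Qed.

End Flat.

(** * Finite free resolutions of cyclic modules *)

Definition spans_row_kernel (R : pzRingType) r q p (B : 'M[R]_(r, q))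
    (A : 'M[R]_(q, p)) : Prop :=
  forall a : 'rV[R]_q, a *m A = 0 <-> exists c, a = c *m B.

(** The resolution of Rx: D 1 presents the annihilator of x. Starting with a
term of rank q 0 = 0 makes Hom the Ext group of index 0, with no special case:
[hom_exact (D 0) (D 1)] says that there is no nonzero map from Rx. *)
Lemma cyclic_free_resolution (R : pzRingType) (M : lmodType R) (x : M) :
  left_noetherian R ->
  exists (q : nat -> nat) (D : forall i, 'M[R]_(q i.+1, q i)),
  [/\ q 0%N = 0%N, q 1%N = 1%N,
      forall a : 'rV[R]_(q 1%N),
        act a (fun=> x) 0 = 0 <-> exists c, a = c *m D 1%N
    & forall i, spans_row_kernel (D i.+2) (D i.+1)].
Proof.
move=> noethR.
have sAnn : submodule [set a : 'rV[R]_1 | act a (fun=> x) 0 = 0]%classic.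
  rewrite (_ : mkset _ = [set a : 'rV[R]_1 | a 0 0 *: x = 0]%classic).
    split=> /= [|a b ax bx|r a ax]; first by rewrite mxE scale0r.
      by rewrite mxE scalerDl ax bx addr0.
    by rewrite mxE -scalerA ax scaler0.
  by apply/seteqP; split=> a; rewrite /= /act big_ord1.
have [q2 [D1 D1P]] := row_span_matrix noethR sAnn.
(* Each matrix is paired with both its dimensions, so that the number of columns
   of the next one is, by computation, the number of rows of this one. *)
pose stage := {p : nat & {q : nat & 'M[R]_(q, p)}}.
have nextP (s : stage) : exists s2 : {r : nat & 'M[R]_(r, projT1 (projT2 s))},
    spans_row_kernel (projT2 s2) (projT2 (projT2 s)).
  case: s => p [q A] /=.
  have sK : submodule [set a : 'rV[R]_q | a *m A = 0]%classic.
    split=> /= [|a b aA bA|r a aA]; first exact: mul0mx.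
      by rewrite mulmxDl aA bA addr0.
    by rewrite -scalemxAl aA scaler0.
  by have [r [B BP]] := row_span_matrix noethR sK; exists (existT _ r B).
pose next s := projT1 (cid (nextP s)).
pose succ (s : stage) : stage := existT _ (projT1 (projT2 s)) (next s).
pose s1 : stage := existT _ 1%N (existT _ q2 D1).
pose s i : stage := if i is j.+1 then iter j succ s1
                    else existT _ 0%N (existT _ 1%N (0 : 'M[R]_(1, 0))).
pose q i := projT1 (s i).
pose D i : 'M[R]_(q i.+1, q i) := 
  if i is j.+1 then projT2 (projT2 (s j.+1)) else 0.
exists q, D; split=> // i a.
exact: (projT2 (cid (nextP (s i.+1)))).
Qed.

Lemma row_kernel_mul0 (R : pzRingType) r q p (B : 'M[R]_(r, q))
    (A : 'M[R]_(q, p)) : spans_row_kernel B A -> B *m A = 0.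
Proof.
move=> BA; apply/row_matrixP => k; rewrite row_mul row0; apply/BA.
by exists (delta_mx 0 k); rewrite rowE.
Qed.

(** * Direct sums and cogenerators *)

Lemma injective_module_prod (R : pzRingType) (V W : lmodType R) :
  injective_module V -> injective_module W ->
  injective_module ((V * W)%type : lmodType R).
Proof.
move=> injV injW A B f g inj_f.
have [h hE] := injV _ _ f (fst \o g) inj_f.
have [k kE] := injW _ _ f (snd \o g) inj_f.
have lin_hk : linear (fun b => (h b, k b) : (V * W)%type).
  by move=> a b c; rewrite !linearP.
pose hkL := GRing.isLinear.Build R B (V * W)%type *:%R _ lin_hk.
pose hk : {linear B -> (V * W)%type} := HB.pack (fun b => (h b, k b)) hkL.
exists hk => a /=; rewrite hE kE /=.
by case: (g a).
Qed.

Lemma direct_sum_injective (R : pzRingType) (I : nat -> lmodType R) n :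
  (forall i, injective_module (I i)) -> injective_module (direct_sum I n).
Proof.
move=> injI; elim: n => [|n IH] /=; first exact: injI.
exact: injective_module_prod.
Qed.

Lemma direct_sum_in (R : pzRingType) (I : nat -> lmodType R) n i :
  (i <= n)%N -> exists f : {linear I i -> direct_sum I n}, injective f.
Proof.
elim: n => [|n IH]; first by rewrite leqn0 => /eqP ->; exists idfun.
rewrite leq_eqVlt ltnS => /orP [/eqP ->|/IH [f inj_f]].
  have lin_g : linear (fun x : I n.+1 =>
      (0, x) : (direct_sum I n * I n.+1)%type).
    by move=> a x y; congr (_, _); rewrite /= scaler0 addr0.
  pose gL := GRing.isLinear.Build R (I n.+1) (direct_sum I n.+1) *:%R _ lin_g.
  pose g : {linear I n.+1 -> direct_sum I n.+1} :=
    HB.pack (fun x : I n.+1 => (0, x) : (direct_sum I n * I n.+1)%type) gL.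
  by exists g => // x y [].
have lin_g : linear (fun x => (f x, 0) : (direct_sum I n * I n.+1)%type).
  by move=> a x y; congr (_, _); rewrite /= ?linearP ?scaler0 ?addr0.
pose gL := GRing.isLinear.Build R (I i) (direct_sum I n.+1) *:%R _ lin_g.
pose g : {linear I i -> direct_sum I n.+1} :=
  HB.pack (fun x => (f x, 0) : (direct_sum I n * I n.+1)%type) gL.
by exists g => // x y [/inj_f].
Qed.

(** The index set of the product is the set of all maps from Y to X, and the
embedding is evaluation. *)
Lemma cogenerator_forP (R : pzRingType) (C : lmodType R -> Prop)
    (X : lmodType R) :
  (forall (Y : lmodType R) (y : Y), C Y ->
     (forall h : {linear Y -> X}, h y = 0) -> y = 0) ->
  cogenerator_for C X.
Proof.
move=> sep Y CY; exists {linear Y -> X}.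
pose ev (y : Y) : {linear Y -> X} -> X := fun h => h y.
have lin_ev : linear ev by move=> a x y; apply/funext => h; exact: linearP.
pose evL := GRing.isLinear.Build R Y ({linear Y -> X} -> X) *:%R ev lin_ev.
pose ev' : {linear Y -> ({linear Y -> X} -> X)} := HB.pack ev evL.
exists ev' => x y xy; apply/subr0_eq/(sep Y) => // h.
by rewrite linearB; apply/eqP; rewrite subr_eq0; apply/eqP;
   exact: (congr1 (fun f => f h) xy).
Qed.

(** * The two dimension shifts *)

(** In terms of X = Rx: Ext^i(X, -) vanishes on the cosyzygies of R, by
ascending induction on i, then on R, then on flat modules, then on the syzygies
of Y, by descending induction on i, and finally Hom(X, Y) = 0. *)
Lemma eq0_of_maps_to_resolution (R : pzRingType) (n : nat)
    (noethR : left_noetherian R)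
    (I : nat -> lmodType R) (eps : {linear R^o -> I 0%N})
    (d : forall i, {linear I i -> I i.+1}) (Y : lmodType R) (x : Y) :
  injective eps -> range eps = ker (d 0%N) ->
  (forall i, range (d i) = ker (d i.+1)) ->
  (forall i, injective_module (I i)) ->
  flat_dim_le n Y ->
  (forall i, (i <= n)%N -> forall h : {linear Y -> I i}, h x = 0) -> x = 0.
Proof.
move=> inj_eps Reps Rd injI [F [del [e [flatF F0 Re Rdel0 Rdel]]]] kill.
have [q [D [q0 q1 D1x DD]]] := cyclic_free_resolution x noethR.
have D0 (N : lmodType R) (v : 'I_(q 0) -> N) : act (D 0%N) v =1 fun=> 0.
  by move=> k; apply: big1 => -[j jq]; exfalso; rewrite q0 in jq.
have DS i : D i.+1 *m D i = 0.
  case: i => [|i]; last exact: row_kernel_mul0.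
  by apply/matrixP => k [j jq]; exfalso; rewrite q0 in jq.
have exI j i : hom_exact (D i.+1) (D i.+2) [set: I j]%classic.
  by apply: injective_hom_exact => // a /(DD i).
(* The kernel of d j is the cosyzygy of index j, a copy of R when j = 0. *)
have exker i j : (i + j <= n)%N -> hom_exact (D i) (D i.+1) (ker (d j)).
  elim: i j => [|i IH] j ijn.
    move=> u _ D1u; exists (fun=> 0) => [k|k]; first exact: linear0.
    have [//|a /D1x //|h hE] := injective_extend_family (y := fun=> x) _ _ D1u.
    by rewrite D0 -hE kill.
  apply: (hom_exact_ker (DS i) (exI j i)); rewrite Rd; apply: IH.
  by rewrite addnS -addSn.
have exR i : (i <= n)%N -> hom_exact (D i) (D i.+1) [set: R^o]%classic.
  move=> le_in u _ Du; have := exker i 0%N; rewrite addn0 -Reps.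
  move=> /(_ le_in (fun k => eps (u k))) [k|k|v Rv Dv].
  - by exists (u k).
  - by rewrite act_map Du linear0.
  have [w wE] := choice (fun j => let: ex_intro2 y _ gy := Rv j in
    ex_intro (fun y => eps y = v j) y gy).
  exists w => // k; apply: inj_eps; rewrite -act_map -Dv.
  by apply: eq_act => j; rewrite wE.
have exF i j : (i <= n)%N -> hom_exact (D i) (D i.+1) [set: F j]%classic.
  by move=> le_in; apply: flat_hom_exact; [exact: flatF|exact: exR].
(* The range of del i is the syzygy of index i.+1; at i = n it is zero. *)
have exrange m i : (i + m = n)%N ->
    hom_exact (D i.+1) (D i.+2) (range (del i)).
  elim: m i => [|m IH] i; rewrite ?addn0 => imn.
    move=> u Ru _; exists (fun=> 0) => k; first by exists 0; rewrite ?linear0.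
    have [y _ <-] := Ru k.
    by rewrite act0 (F0 i.+1 _ y) ?linear0 // imn.
  have lt_in : (i < n)%N by rewrite -imn addnS ltnS leq_addr.
  apply: (hom_exact_range (DS i.+2) (exF _ _ _)) => //.
  by rewrite -Rdel; apply: IH; rewrite addSnnS.
have ex0 : hom_exact (D 0%N) (D 1%N) [set: Y]%classic.
  rewrite -Re; apply: (hom_exact_range (DS 1%N) (exF _ _ _)) => //.
  by rewrite -Rdel0; exact: (exrange n).
have [//|k|v _ /(_ (cast_ord (esym q1) ord0)) <-] := ex0 (fun=> x).
  have <- : act (row k (D 1%N)) (fun=> x) 0 = 0.
    by apply/D1x; exists (delta_mx 0 k); rewrite rowE.
  by apply: eq_bigr => j _; rewrite mxE.
exact: D0.
Qed.

Theorem theorem2p8 (R : pzRingType) (n : nat)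
    (noethR : left_noetherian R)
    (I : nat -> lmodType R) (eps : {linear R^o -> I 0%N})
    (d : forall i, {linear I i -> I i.+1})
    (resI : minimal_injective_resolution R^o I eps d) :
  injective_cogenerator_for (flat_dim_le n) (direct_sum I n).
Proof.
have [[inj_eps Reps Rd] injI _ _] := resI.
split; first exact: direct_sum_injective.
apply: cogenerator_forP => Y y fdY kill.
apply: (eq0_of_maps_to_resolution noethR inj_eps Reps Rd injI fdY) => i le_in h.
have [f inj_f] := direct_sum_in I le_in.
by apply: inj_f; rewrite linear0; exact: (kill (f \o h)).
Qed.
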